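(* For every topological space $X$, the space $X^{\leq\omega}$ with the asymptotic subword topology is Noetherian if and only if $X$ is Noetherian. Similarly, for every topological space $X$, the space $X^\omega$ with the asymptotic subword topology is Noetherian if and only if $X$ is Noetherian.
   Context: A topological space is Noetherian if every open subset is compact (every open cover has a finite subcover; no separation is assumed). $X^*$ is the set of finite words over $X$, $X^\omega$ the set of infinite words (functions $\mathbb{N} \to X$), and $X^{\leq\omega} = X^* \cup X^\omega$. For open subsets $U_1, \ldots, U_n, U$ of $X$ ($n \in \mathbb{N}$), $\langle U_1; \cdots; U_n\rangle$ is the set of finite or infinite words containing a letter in $U_1$, then at a later position a letter in $U_2$, and so on, until a letter in $U_n$ (for $n=0$, all words); $\langle U_1; \cdots; U_n; (\infty) U\rangle$ is the set of (infinite) words that can be written as a concatenation $uw$ with $u$ a finite word in $\langle U_1; \cdots; U_n\rangle$ and $w$ having letters from $U$ at infinitely many positions. The asymptotic subword topology on $X^{\leq\omega}$ is generated by all these sets as subbasic open sets; on $X^\omega$ it is the subspace topology. *)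

(* Defs.v *)
From HB Require Import structures.
From mathcomp Require Import all_boot.
From mathcomp Require Import boolp classical_sets cardinality topology.

Set Implicit Arguments.
Unset Strict Implicit.
Unset Printing Implicit Defensive.

Local Open Scope classical_set_scope.

Definition noetherian (T : topologicalType) : Prop :=
  forall U : set T, open U -> cover_compact U.

Variant word (X : Type) : Type :=
  | FinWord of seq X
  | InfWord of nat -> X.

HB.instance Definition _ (X : Type) := gen_eqMixin (word X).
HB.instance Definition _ (X : Type) := gen_choiceMixin (word X).

Section Words.
Variable X : Type.

(* [None] when [i] is past the end of a finite word. *)
Definition letter (w : word X) (i : nat) : option X :=
  match w with
  | FinWord s => onth s i
  | InfWord f => Some (f i)
  end.

Definition prepend (u : seq X) (w : word X) : word X :=
  match w with
  | FinWord s => FinWord (u ++ s)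
  | InfWord f => InfWord (fun i => odflt (f (i - size u)) (onth u i))
  end.

(* The set <U_1; ...; U_n>: [p] lists the positions of the chosen letters. *)
Definition subword_set (Us : seq (set X)) : set (word X) :=
  [set w | exists p : seq nat,
    [/\ size p = size Us, sorted ltn p &
      forall k, k < size Us ->
        exists2 x, letter w (nth 0 p k) = Some x & nth set0 Us k x]].

Definition inf_often (U : set X) : set (word X) :=
  [set w | infinite_set [set i | exists2 x, letter w i = Some x & U x]].

(* The set <U_1; ...; U_n; (oo) U>. *)
Definition asubword_set (Us : seq (set X)) (U : set X) : set (word X) :=
  [set v | exists (u : seq X) (w : word X),
    [/\ v = prepend u w, subword_set Us (FinWord u) & inf_often U w]].

End Words.

Definition asymptotic_subbase (X : topologicalType) : set (set (word X)) :=
  [set W | exists2 Us : seq (set X),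
     {in Us, forall V, open V} & W = subword_set Us] `|`
  [set W | exists Us : seq (set X), exists U : set X,
     [/\ {in Us, forall V, open V}, open U & W = asubword_set Us U]].

HB.instance Definition _ (X : topologicalType) :=
  isSubBaseTopological.Build (word X) (@asymptotic_subbase X) id.

(* Not [nat -> X] itself, which the library equips with the product topology. *)
Definition infword (X : topologicalType) : Type :=
  initial_topology (@InfWord X).

HB.instance Definition _ (X : topologicalType) :=
  Topological.copy (infword X) (initial_topology (@InfWord X)).

(* Main.v *)
Require Import Defs.
From mathcomp Require Import all_boot finmap.
From mathcomp Require Import boolp classical_sets cardinality filter topology.
From mathcomp Require Import zify.

(** <U_1; ...; U_n; (oo) U> is the intersection of <U_1; ...; U_n> and of the
    set of words meeting U infinitely often, so the sets of these two kinds
    form a subbase.  Call a family of sets good if every sequence of members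
    S_n with points x_n in S_n has some i < j with x_j in S_i.  If a space has
    a subbase which is the union of two good families, then it is Noetherian:
    for an ultrafilter F, goodness makes the union of all F-null members of a
    family F-null again, hence F converges to F-almost every point.  The sets
    <U_1; ...; U_n> are good by a minimal bad sequence argument, and the sets
    of words meeting U infinitely often by the pigeonhole principle, as a union
    of opens of X is already a finite union.  Conversely X embeds into X^omega
    as the constant words, and Noetherianness passes to initial topologies. *)

Set Implicit Arguments.
Unset Strict Implicit.
Unset Printing Implicit Defensive.

Local Open Scope classical_set_scope.

(** * Infinite sets of numbers and choice along prefixes *)

Lemma infinite_natP (A : set nat) :
  infinite_set A <-> forall n, exists2 i, n <= i & A i.
Proof.
split=> [Ainf n|Aunb /finite_seqP[s As]].
  apply: contrapT => An; apply: Ainf; apply: sub_finite_set (finite_II n).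
  by move=> i Ai /=; rewrite ltnNge; apply/negP => ni; apply: An; exists i.
have [i + Ai] := Aunb (\max_(i <- s) i).+1.
rewrite ltnNge => /negP; apply.
by apply: leq_bigmax_seq => //; move: Ai; rewrite As.
Qed.

(** Each term may depend on all earlier ones: the prefix is built by iterated appending. Often
    [P s x] is an implication whose premise on [s] is afterwards proved along the sequence by
    induction. *)
Lemma prefix_choice (T : Type) (P : seq T -> T -> Prop) :
  (forall s, exists x, P s x) -> exists f : nat -> T, forall n, P (mkseq f n) (f n).
Proof.
move=> /choice[g Pg]; pose s n := iter n (fun t => rcons t (g t)) [::].
exists (g \o s) => n; suff -> : mkseq (g \o s) n = s n by exact: Pg.
by elim: n => // n IH; rewrite mkseqS IH.
Qed.

(** * Good sequences, subsequences and minimal bad sequences *)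

Section GoodSequences.
Variable T : Type.
Implicit Types (P : T -> Prop) (R : T -> T -> Prop).

Definition good R (f : nat -> T) := exists i j, i < j /\ R (f i) (f j).

Definition almost_full P R := forall f, (forall n, P (f n)) -> good R f.

(** Otherwise each [i] in [J] has a bound [b i] from which on no element of [J] is related to it;
    choosing elements of [J] beyond all earlier bounds gives a bad sequence. *)
Lemma almost_full_pivot P R f (J : set nat) : almost_full P R ->
    (forall n, P (f n)) -> infinite_set J ->
  exists2 i, J i & infinite_set [set j | J j /\ R (f i) (f j)].
Proof.
move=> afR Pf /infinite_natP Jinf; apply: contrapT => nJ.
have /choice[b bP] i : exists b, J i -> forall j, b <= j -> J j -> ~ R (f i) (f j).
  have [Ji|] := pselect (J i); last by exists 0.
  apply: contrapT => nb; apply: nJ; exists i => //; apply/infinite_natP => n.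
  apply: contrapT => nn; apply: nb; exists n => _ j nj Jj Rij.
  by apply: nn; exists j.
have [|g gP] := @prefix_choice _ (fun s n => J n /\ {in s, forall m, b m <= n}).
  move=> s; have [i si Ji] := Jinf (\max_(m <- s) b m).
  exists i; split=> // m ms; apply: leq_trans si.
  exact: leq_bigmax_seq.
have [i [j [ij Rij]]] := afR (f \o g) (fun n => Pf (g n)).
have [Jj bj] := gP j; have [Ji _] := gP i.
apply: bP Rij => //; apply: bj; apply/mapP; exists i => //.
by rewrite mem_iota.
Qed.

(** Ramsey argument: [K s] holds the indices that can still follow [s], and pivots are chosen so
    that it stays infinite. *)
Lemma almost_full_subseq P R f : almost_full P R -> (forall n, P (f n)) ->
  exists g : nat -> nat,
    forall i j, i < j -> g i < g j /\ R (f (g i)) (f (g j)).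
Proof.
move=> afR Pf.
pose K (s : seq nat) := [set j | {in s, forall m, m < j /\ R (f m) (f j)}].
have [|g gP] := @prefix_choice _ (fun s n =>
    infinite_set (K s) -> K s n /\ infinite_set (K (rcons s n))).
  move=> s; have [Ks|] := pselect (infinite_set (K s)); last by exists 0.
  have [i Ki /infinite_natP Jinf] := almost_full_pivot afR Pf Ks.
  exists i => _; split=> //; apply/infinite_natP => n.
  (* The pivot does not ensure [i < j], hence the bound [i.+1]. *)
  have [j nj [Kj Rij]] := Jinf (maxn n i.+1).
  exists j; first by lia.
  by move=> m; rewrite mem_rcons inE => /orP[/eqP ->|/Kj //]; split => //; lia.
have Kg n : infinite_set (K (mkseq g n)).
  elim: n => [|n /gP[_]]; last by rewrite mkseqS.
  by apply/infinite_natP => n; exists n.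
exists g => i j ij; have [+ _] := gP j (Kg j); apply.
by apply/mapP; exists i => //; rewrite mem_iota.
Qed.

(** Each term is chosen [mu]-least among those that extend the earlier terms to a prefix of a bad
    sequence. *)
Lemma minimal_bad_sequence P R (mu : T -> nat) : ~ almost_full P R ->
  exists f, [/\ forall n, P (f n), ~ good R f &
    forall h n, (forall k, k < n -> h k = f k) -> (forall k, P (h k)) ->
      mu (h n) < mu (f n) -> good R h].
Proof.
move=> nafR; pose bad f := (forall n, P (f n)) /\ ~ good R f.
pose ext s := exists2 f, bad f & mkseq f (size s) = s.
have [|f fP] := @prefix_choice _ (fun s x => ext s ->
    ext (rcons s x) /\ forall y, ext (rcons s y) -> mu x <= mu y).
  move=> s; have [[f0 bad0 f0s]|ns] := pselect (ext s); last first.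
    (* For a prefix without bad extension any value serves; [T] has one, as over an empty type every
       relation is almost full. *)
    have [t] : inhabited T; last by exists t.
    apply: contrapT => nT; apply: nafR => f.
    by case: nT; exists; exact: f 0.
  pose Q n := `[< exists2 y, ext (rcons s y) & mu y = n >].
  have exQ : exists n, Q n.
    exists (mu (f0 (size s))); apply/asboolP; exists (f0 (size s)) => //.
    by exists f0 => //; rewrite size_rcons mkseqS f0s.
  have [n /asboolP[x extx <-] minn] := ex_minnP exQ.
  exists x => _; split=> // y exty; apply: minn; apply/asboolP.
  by exists y.
have extf n : ext (mkseq f n).
  elim: n => [|n /fP[]]; last by rewrite mkseqS.
  apply: contrapT => n0; apply: nafR => f0 Pf0; apply: contrapT => bad0.
  by apply: n0; exists f0.
have prefixE h n k : mkseq h n = mkseq f n -> k < n -> h k = f k.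
  by move=> hf kn; rewrite -(nth_mkseq (f 0) h kn) hf nth_mkseq.
exists f; split.
- move=> n; have [h [Ph _]] := extf n.+1; rewrite size_mkseq => /prefixE <- //.
- move=> [i [j [ij Rij]]]; have [h [_ badh]] := extf j.+1.
  rewrite size_mkseq => /prefixE hf; apply: badh; exists i, j.
  by rewrite !hf //; exact: leq_trans ij _.
- move=> h n hf Ph hn; apply: contrapT => badh.
  (* Were [h] bad, [h n] would compete with the least choice [f n]. *)
  have [_ fmin] := fP n (extf n); move: hn; rewrite ltnNge => /negP; apply.
  apply: fmin.
  exists h => //; rewrite size_rcons size_mkseq mkseqS; congr rcons.
  by apply/eq_in_map => k; rewrite mem_iota => /hf.
Qed.

End GoodSequences.

(** * Good families and ultrafilters *)

(** The family is indexed because the minimal bad sequence argument measures the list of opens,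
    which its set of words does not determine. *)
Definition good_family (I T : Type) (D : set I) (S : I -> set T) :=
  almost_full (fun p : I * T => D p.1 /\ S p.1 p.2) (fun p q => S p.1 q.2).

(** If the union were in [F], one could choose again and again a point of it outside the finitely
    many null members used so far, together with a null member containing it: a bad sequence. *)
Lemma ultra_bigcup_null (I : choiceType) (T : Type) (D : set I) (S : I -> set T)
    (F : set_system T) : UltraFilter F -> good_family D S ->
  ~ F (\bigcup_(i in [set i | D i /\ ~ F (S i)]) S i).
Proof.
move=> FU gDS FN.
have [|f fP] := @prefix_choice (I * T)%type (fun s p =>
    {in [seq p.1 | p <- s], forall i, ~ F (S i)} ->
    [/\ D p.1, S p.1 p.2, ~ F (S p.1) &
        {in [seq p.1 | p <- s], forall i, ~ S i p.2}]).
  move=> s; set s1 := [seq p.1 | p <- s].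
  have [Ns|] := pselect ({in s1, forall i, ~ F (S i)}); last first.
    have [[i x] _] : exists p : I * T, True.
      by have [x [i _ _]] := filter_ex FN; exists (i, x).
    by exists (i, x).
  have : F (\bigcap_(i in [set` [fset i in s1]%fset]) ~` S i).
    apply: filter_bigI => i; rewrite inE => /Ns.
    by case: (in_ultra_setVsetC (S i) FU).
  move=> /(filterI FN) /filter_ex[x [[i [Di Ni] Six] nx]].
  by exists (i, x) => _; split=> // j js; apply: nx; rewrite /= inE.
have null n : {in [seq p.1 | p <- mkseq f n], forall i, ~ F (S i)}.
  elim: n => // n IH i; have [_ _ ni _] := fP _ IH.
  by rewrite mkseqS map_rcons mem_rcons inE => /orP[/eqP ->|/IH].
have [n|i [j [ij Sij]]] := gDS f; first by have [] := fP _ (null n).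
have [_ _ _ nS] := fP _ (null j); apply: (nS _ _ Sij).
by rewrite /mkseq -map_comp; apply/mapP; exists i => //; rewrite mem_iota.
Qed.

(** Without a finite subcover the sets [B J] generate a proper filter. An ultrafilter above it
    contains [A], so it converges to a point of [A]; it then contains some [f i] and also [B
    [fset i]], which is disjoint from [f i]. *)
Lemma ultra_noetherian (T : topologicalType) :
    (forall F : set_system T, UltraFilter F -> F [set x | F --> x]) ->
  noetherian T.
Proof.
move=> cvgF A _ I D f fop Af; apply: contrapT => nfin.
pose B (J : {fset I}) := A `\` cover [set` J] f.
pose fin : set {fset I} := [set J | {subset J <= D}].
have FF : Filter (filter_from fin B).
  apply: filter_from_filter; first by exists fset0.
  move=> J K sJ sK; exists (J `|` K)%fset.
    by move=> i /fsetUP[/sJ|/sK].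
  by move=> x [Ax ncov]; split; split=> // -[i /= iJK fix_]; apply: ncov;
    exists i => //=; rewrite inE iJK ?orbT.
have FP : ProperFilter (filter_from fin B).
  apply: filter_from_proper => J sJ; apply: contrapT => nJ.
  apply: nfin; exists J => // x Ax; apply: contrapT => ncov.
  by apply: nJ; exists x.
have [G [GU FG]] := ultraFilterLemma FP.
have GA : G A by apply: FG; exists fset0 => // x [].
have [x [/Af[i Di fix_] cvgx]] := filter_ex (filterI GA (cvgF G GU)).
have Gfi : G (f i) by apply: cvgx; apply: open_nbhs_nbhs; split=> //; exact: fop.
have Gi : G (B [fset i]%fset).
  by apply: FG; exists [fset i]%fset => // j; rewrite inE => /eqP ->; rewrite inE.
have [y [fiy [_ ncov]]] := filter_ex (filterI Gfi Gi).
by apply: ncov; exists i => //=; rewrite inE.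
Qed.

(** * Noetherian spaces *)

Lemma noetherian_finite_bigcup (T : topologicalType) (U : nat -> set T) :
    noetherian T -> (forall n, open (U n)) ->
  exists n, \bigcup_i U i = \bigcup_(i in `I_n) U i.
Proof.
move=> noeT Uop; have oU : open (\bigcup_i U i) by exact: bigcup_open.
have [//|//|J _ UJ] := noeT _ oU nat setT U.
exists (\max_(i <- J) i).+1; apply/seteqP; split; last exact: bigcup_subset.
move=> x /UJ[i iJ Uix]; exists i => //=; rewrite ltnS.
exact: leq_bigmax_seq.
Qed.

(** Some first [n] of the opens already cover the union, which contains the point with index [n]. *)
Lemma noetherian_good (T : topologicalType) :
  noetherian T -> good_family (open : set (set T)) id.
Proof.
move=> noeT f fP.
have [|n Un] := @noetherian_finite_bigcup T (fun i => (f i).1) noeT.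
  by move=> n; have [] := fP n.
have : (\bigcup_i (f i).1) (f n).2 by exists n => //; have [] := fP n.
by rewrite Un => -[i /= ni fi]; exists i, n.
Qed.

Lemma noetherian_initial (S T : topologicalType) (c : S -> T) :
    (forall U : set S, open U -> exists2 V : set T, open V & U = c @^-1` V) ->
  noetherian T -> noetherian S.
Proof.
move=> cP noeT U _ I D f fop Uf.
have /choice[g gP] i : exists V : set T, D i -> open V /\ f i = c @^-1` V.
  have [Di|] := pselect (D i); last by exists set0.
  by have [V Vop fV] := cP _ (fop i Di); exists V.
have gop i : D i -> open (g i) by move=> /gP[].
have [//|J JD gJ] := noeT _ (bigcup_open gop) I D g gop.
exists J => // x /Uf[i Di fix_].
have [|j jJ gj] := gJ (c x).
  by exists i => //; move: fix_; have [_ ->] := gP i Di.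
by exists j => //; have /JD := jJ; rewrite inE => /gP[_ ->].
Qed.

(** * Words and their subword sets *)

Section Words.
Variable X : Type.
Implicit Types (w v : word X) (U : set X) (Us : seq (set X)).

Lemma letter_prepend (u : seq X) w i :
  letter (prepend u w) i =
  if i < size u then onth u i else letter w (i - size u).
Proof.
case: w => [s|f] /=; first by rewrite onth_cat.
case: ltnP => [|ui]; last by rewrite onth_default.
by rewrite -onthTE; case: (onth u i).
Qed.

Definition wdrop n w : word X :=
  match w with
  | FinWord s => FinWord (drop n s)
  | InfWord f => InfWord (fun i => f (n + i))
  end.

Lemma letter_wdrop n w i : letter (wdrop n w) i = letter w (n + i).
Proof. by case: w => [s|f] //=; rewrite !onthE map_drop nth_drop. Qed.

Lemma subword_set0 w : subword_set [::] w.
Proof. by exists [::]. Qed.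

(** Serves for words extended on the left, with [h] a shift, and on the right, with [h] the
    identity. *)
Lemma subword_set_embed (h : nat -> nat) Us v w :
    {homo h : i j / i < j} ->
    (forall i x, letter v i = Some x -> letter w (h i) = Some x) ->
  subword_set Us v -> subword_set Us w.
Proof.
move=> hmono hletter [p [sp sortp pU]]; exists (map h p); split.
- by rewrite size_map.
- by rewrite (homo_sorted hmono).
- move=> k kU; have [x vx Ux] := pU k kU; exists x => //.
  by rewrite (nth_map 0) ?sp //; exact: hletter.
Qed.

Lemma subword_set_wdrop n Us w : subword_set Us (wdrop n w) -> subword_set Us w.
Proof.
apply: (@subword_set_embed (addn n)) => [i j|i x]; first by rewrite ltn_add2l.
by rewrite letter_wdrop.
Qed.

Lemma subword_set_cons U Us w :
  subword_set (U :: Us) w <->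
  exists i x, [/\ letter w i = Some x, U x & subword_set Us (wdrop i.+1 w)].
Proof.
split=> [[[|i p] [//= [sp] sortp pU]]|[i [x [wi Ux [p [sp sortp pU]]]]]].
  have [x wi Ux] := pU 0 isT; exists i, x; split=> //.
  have /allP ip := order_path_min ltn_trans sortp.
  exists (map (subn^~ i.+1) p); split; first by rewrite size_map.
    rewrite sorted_map.
    apply: (sub_in_sorted (P := mem p)) (path_sorted sortp); last exact/allP.
    by move=> j k /ip ij /ip ik /= jk; lia.
  move=> k kU; have [y wk Uy] := pU k.+1 kU; exists y => //.
  rewrite letter_wdrop (nth_map 0) ?sp // subnKC //.
  by apply: ip; rewrite mem_nth ?sp.
exists (i :: map (addn i.+1) p); split=> /=; first by rewrite size_map sp.
  rewrite path_min_sorted; last by apply/allP => _ /mapP[j _ ->]; lia.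
  by apply: homo_sorted sortp => j k /=; rewrite ltn_add2l.
move=> [|k] /= kU; first by exists x.
have [y wk Uy] := pU k kU; exists y => //.
by rewrite (nth_map 0) ?sp // -letter_wdrop.
Qed.

(** Prepending [u] keeps the letters of [u] in place and shifts those of [w]. Conversely the word
    must be infinite, and it can be cut after the last chosen position. *)
Lemma asubword_setE Us U : asubword_set Us U = subword_set Us `&` inf_often U.
Proof.
apply/seteqP; split=> [_ [u [w [-> uUs /infinite_natP wU]]]|v].
  split.
    apply: (@subword_set_embed id) uUs => // i x ui.
    by rewrite letter_prepend -onthTE; move: ui => /= ->.
  apply/infinite_natP => n; have [i ni [x wi Ux]] := wU n.
  exists (size u + i); first by lia.
  by exists x => //; rewrite letter_prepend ltnNge leq_addr addKn.
case: v => [s [_ /infinite_natP sU]|f [[p [sp sortp pU]] /infinite_natP fU]].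
  by have [i si [x]] := sU (size s); rewrite /= onth_default.
pose n := (\max_(i <- p) i).+1.
have pn i : i \in p -> i < n by move=> ip; rewrite ltnS; exact: leq_bigmax_seq.
have onthf i : i < n -> onth (mkseq f n) i = Some (f i).
  by move=> ni; rewrite onth_map onthE (nth_map 0) ?size_iota // nth_iota.
exists (mkseq f n), (InfWord (fun i => f (n + i))); split.
- rewrite /=; congr InfWord; apply/funext => i; rewrite size_map size_iota.
  case: (ltnP i n) => ni; first by rewrite onthf.
  by rewrite onth_default ?size_mkseq //= subnKC.
- exists p; split=> // k kU; have [x [<-] Ux] := pU k kU.
  by exists (f (nth 0 p k)) => //=; rewrite onthf // pn // mem_nth // sp.
- apply/infinite_natP => m; have [i mi [x [fi] Ux]] := fU (n + m).
  exists (i - n); first by lia.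
  by exists x => //=; rewrite subnKC ?fi //; lia.
Qed.

(** Pigeonhole: finitely many finite sets of positions have a finite union. *)
Lemma inf_often_bigcup (U : nat -> set X) n :
  inf_often (\bigcup_(i in `I_n) U i) = \bigcup_(i in `I_n) inf_often (U i).
Proof.
apply/seteqP; split=> w; last first.
  move=> [i ni]; apply: sub_infinite_set => j [x wj Ux].
  by exists x => //; exists i.
move=> winf; apply: contrapT => nw; apply: winf.
rewrite (_ : mkset _ =
    \bigcup_(i in `I_n) [set j | exists2 x, letter w j = Some x & U i x]).
  apply: bigcup_finite (finite_II n) _ => i ni; apply: contrapT => wi.
  by apply: nw; exists i.
apply/seteqP; split=> j; first by move=> [x wj [i ni Ux]]; exists i => //; exists x.
by move=> [i ni [x wj Ux]]; exists x => //; exists i.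
Qed.

End Words.

(** * Goodness of the two families of word sets *)

(* Nash-Williams: from a bad sequence minimal for the number of opens, strip
   from each <U; Us> the open U and from its word a prefix ending in U. *)
Lemma subword_set_good (X : topologicalType) : noetherian X ->
  good_family [set Us : seq (set X) | {in Us, forall V, open V}] (@subword_set X).
Proof.
move=> noeX; apply: contrapT.
move=> /(@minimal_bad_sequence _ _ _ (fun p => size p.1))[f [Pf badf fmin]].
have /choice[d dP] n : exists d : set X * seq (set X) * (X * word X),
    [/\ (f n).1 = d.1.1 :: d.1.2, open d.1.1 /\ {in d.1.2, forall V, open V},
        d.1.1 d.2.1, subword_set d.1.2 d.2.2 &
        (forall Us, subword_set Us d.2.2 -> subword_set Us (f n).2) /\
        forall V Us, V d.2.1 -> subword_set Us d.2.2 ->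
          subword_set (V :: Us) (f n).2].
  have [] := Pf n; case fn : (f n).1 => [|U Us] oU.
    (* An empty list makes the sequence good, since its set contains every word. *)
    case: badf; exists n, n.+1; split=> //.
    by rewrite fn; exact: subword_set0.
  move=> /subword_set_cons[i [x [wi Ux wUs]]].
  exists (U, Us, (x, wdrop i.+1 (f n).2)); split=> //=.
  - split; first by apply: oU; rewrite mem_head.
    by move=> V VUs; apply: oU; rewrite inE VUs orbT.
  - split=> [Vs|V Vs Vx wVs]; first exact: subword_set_wdrop.
    by apply/subword_set_cons; exists i, x.
(* The stripped opens and letters have a subsequence along which every later letter lies in every
   earlier open. *)
pose hx n := ((d n).1.1, (d n).2.1).
have [n|g gP] := almost_full_subseq (f := hx) (noetherian_good noeX).
  by have [_ []] := dP n.
pose m := g 0.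
have mg k : m <= g k by case: k => // k; have [/ltnW] := gP 0 k.+1 isT.
(* Below [m] the minimal sequence, then the stripped subsequence; the list at [m] is shorter by one,
   so [h] is good. *)
pose h k := if k < m then f k else ((d (g (k - m))).1.2, (d (g (k - m))).2.2).
have [k km|k||i [j [ij]]] := fmin h m.
- by rewrite /h km.
- by rewrite /h; case: ifP => // _; have [_ []] := dP (g (k - m)).
- by rewrite /h ltnn subnn; have [-> ] := dP m.
(* Goodness of [h] passes to [f]: a stripped word is a suffix of the original one, and two stripped
   terms regain their opens and letters, which [g] has matched. *)
rewrite /h; case: (ltnP i m) => [im|mi]; case: (ltnP j m) => [jm|mj] Rij.
- by case: badf; exists i, j.
- case: badf; exists i, (g (j - m)); split; first exact: leq_trans im (mg _).
  by have [_ _ _ _ [+ _]] := dP (g (j - m)); apply.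
- by lia.
- have [|gij Hij] := gP (i - m) (j - m); first by lia.
  case: badf; exists (g (i - m)), (g (j - m)); split=> //.
  have [-> _ _ _ _] := dP (g (i - m)).
  by have [_ _ _ _ [_ +]] := dP (g (j - m)); apply.
Qed.

(** As for the opens of [X], with the finite union split by pigeonhole. *)
Lemma inf_often_good (X : topologicalType) : noetherian X ->
  good_family (open : set (set X)) (@inf_often X).
Proof.
move=> noeX f fP; pose U i := (f i).1.
have [|n Un] := @noetherian_finite_bigcup X U noeX.
  by move=> n; have [] := fP n.
have : inf_often (\bigcup_i U i) (f n).2.
  have [_] := fP n; apply: sub_infinite_set => j [x wj Ux].
  by exists x => //; exists n.
by rewrite Un inf_often_bigcup => -[i /= ni fi]; exists i, n.
Qed.

(** * The asymptotic subword topology *)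

Lemma asymptotic_subbase_open (X : topologicalType) (W : set (word X)) :
  asymptotic_subbase W -> open W.
Proof.
move=> WX; exists [set W]; last by rewrite bigcup_set1.
move=> _ ->; exists [fset W]%fset.
  by move=> V /fset1P ->; rewrite inE.
by rewrite set_fset1 bigcap_set1.
Qed.

Lemma asymptotic_subbase_cvg (X : topologicalType) (F : set_system (word X))
    (w : word X) : Filter F ->
  (forall W, asymptotic_subbase W -> W w -> F W) -> F --> w.
Proof.
move=> FF FW A; rewrite /= nbhsE => -[_ [[B sB <-] [C BC Cw]] BA].
apply: filterS BA _; apply: (@filterS _ _ _ C); first by move=> x Cx; exists C.
have /sB[D sD DC] := BC; move: Cw; rewrite -DC => Cw.
apply: filter_bigI => E ED; apply: FW (Cw E ED).
by have := sD E ED; rewrite inE.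
Qed.

Lemma noetherian_word (X : topologicalType) : noetherian X -> noetherian (word X).
Proof.
move=> noeX; apply: ultra_noetherian => F FU.
have nsub := ultra_bigcup_null FU (subword_set_good noeX).
have ninf := ultra_bigcup_null FU (inf_often_good noeX).
set N1 := bigcup _ _ in nsub; set N2 := bigcup _ _ in ninf.
have FN1 : F (~` N1) by case: (in_ultra_setVsetC N1 FU).
have FN2 : F (~` N2) by case: (in_ultra_setVsetC N2 FU).
(* A word outside both null unions has all its subbasic neighbourhoods in [F], hence is a limit of
   [F]. *)
apply: filterS (filterI FN1 FN2) => w [w1 w2] /=.
have Fsub Us : {in Us, forall V, open V} -> subword_set Us w -> F (subword_set Us).
  by move=> oUs wUs; apply: contrapT => nF; apply: w1; exists Us.
have Finf U : open U -> inf_often U w -> F (inf_often U).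
  by move=> oU wU; apply: contrapT => nF; apply: w2; exists U.
apply: asymptotic_subbase_cvg => W [[Us oUs ->]|[Us [U [oUs oU ->]]]].
  exact: Fsub.
by rewrite asubword_setE => -[wUs wU]; apply: filterI; [exact: Fsub|exact: Finf].
Qed.

Theorem theorem5p8 :
  (forall X : topologicalType, noetherian (word X) <-> noetherian X) /\
  (forall X : topologicalType, noetherian (infword X) <-> noetherian X).
Proof.
have word_infword (X : topologicalType) : noetherian (word X) -> noetherian (infword X).
  apply: (@noetherian_initial (infword X) (word X) (@InfWord X)).
  by move=> U [V Vop <-]; exists V.
have infword_letter (X : topologicalType) : noetherian (infword X) -> noetherian X.
  apply: (@noetherian_initial X (infword X) (fun x => fun=> x)) => U Uop.
  (* On constant words [subword_set [:: U]] tests the one repeated letter for membership in [U]. *)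
  exists (@InfWord X @^-1` subword_set [:: U]).
    exists (subword_set [:: U]) => //; apply: asymptotic_subbase_open.
    by left; exists [:: U] => // V; rewrite inE => /eqP ->.
  apply/seteqP; split=> x /= => [Ux|/subword_set_cons[_ [_ [[<-]]]]//].
  by apply/subword_set_cons; exists 0, x; split=> //; exact: subword_set0.
split=> X; split=> [wX|noeX].
- exact/infword_letter/word_infword.
- exact: noetherian_word.
- exact: infword_letter.
- exact/word_infword/noetherian_word.
Qed.
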